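(* Let $\mathbb{K}$ be an infinite field and let $(d_n)_{n\in\mathbb{N}}$ be a sequence of positive integers with $d_n\le n^2$ for all $n$ and $\liminf_{n\to\infty}\frac{d_n}{n^2}>\frac13$. Then for any sufficiently large $n$, the Hilbert series of a generic quadratic $\mathbb{K}$-algebra with $n$ generators and $d_n$ relations is a polynomial of degree at most $4$.
   Context: A quadratic $\mathbb{K}$-algebra with $n$ generators and $d$ relations is $R=\mathbb{K}\langle x_1,\dots,x_n\rangle/I$, where all generators $x_i$ have degree $1$, and $I$ is the two-sided ideal generated by $d$ linearly independent homogeneous elements $f_j=\sum_{k,m=1}^n c_{j,k,m}x_kx_m$, $1\le j\le d$, $c_{j,k,m}\in\mathbb{K}$. It is graded, $R=\bigoplus_{q\ge 0}R_q$, and its Hilbert series is $H_R(t)=\sum_{q\ge0}(\dim_{\mathbb{K}}R_q)t^q$. ''A generic quadratic $\mathbb{K}$-algebra with $n$ generators and $d$ relations has property $\mathcal{P}$'' means: the set of coefficient vectors $(c_{j,k,m})\in\mathbb{K}^{n^2d}$ for which the corresponding algebra $R$ has property $\mathcal{P}$ contains a dense Zariski open subset of $\mathbb{K}^{n^2d}$. *)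

(* Defs.v *)
From HB Require Import structures.
From mathcomp Require Import all_boot all_order all_algebra.
From mathcomp Require Import all_classical all_reals all_analysis.
(* Notations excluded: they clash with those of mathcomp-analysis. *)
From mathcomp Require Import -(notations) monalg mpoly.

Set Implicit Arguments.
Unset Strict Implicit.
Unset Printing Implicit Defensive.

Import Order.TTheory GRing.Theory Num.Theory.

Local Open Scope classical_set_scope.
Local Open Scope ring_scope.
Local Open Scope quotient_scope.

Section LinearAlgebra.
Context {K : fieldType} {V : lmodType K}.

Definition lin_indep k (b : 'I_k -> V) : Prop :=
  forall a : 'I_k -> K, \sum_(i < k) a i *: b i = 0 -> forall i, a i = 0.

Definition has_dim (W : set V) (k : nat) : Prop :=
  exists b : 'I_k -> V,
    [/\ forall i, W (b i),
        lin_indep b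
      & forall v, W v -> exists a : 'I_k -> K, v = \sum_(i < k) a i *: b i].

End LinearAlgebra.

Section IdealQuotient.
Context {K : fieldType} {A : lalgType K}.

Definition two_sided_ideal (J : set A) : Prop :=
  [/\ J 0, forall a b, J a -> J b -> J (a + b)
    & forall a b c, J b -> J (a * b * c)].

Definition ideal_generated {I : Type} (f : I -> A) : set A :=
  [set a | forall J, two_sided_ideal J -> (forall i, J (f i)) -> J a].

Lemma ideal_generatedP {I : Type} (f : I -> A) :
  two_sided_ideal (ideal_generated f).
Proof.
split=> [J [] //|a b Ia Ib J JI Jf|a b c Ib J JI Jf].
  by case: (JI) => _ JD _; apply: JD; [apply: Ia | apply: Ib].
by case: (JI) => _ _ JM; apply: JM; apply: Ib.
Qed.

Definition ideal_pred {I : Type} (f : I -> A) : {pred A} :=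
  fun a => `[< ideal_generated f a >].

Lemma ideal_predE {I : Type} (f : I -> A) a :
  (a \in ideal_pred f) = `[< ideal_generated f a >].
Proof. by []. Qed.

Lemma ideal_predM {I : Type} (f : I -> A) a b c :
  b \in ideal_pred f -> a * b * c \in ideal_pred f.
Proof.
rewrite !ideal_predE => /asboolP Ib; apply/asboolP.
by case: (ideal_generatedP f) => _ _; apply.
Qed.

Lemma ideal_pred_zmod_closed {I : Type} (f : I -> A) :
  zmod_closed (ideal_pred f).
Proof.
case: (ideal_generatedP f) => I0 ID IM.
split; first exact/asboolP.
move=> a b /asboolP Ia /asboolP Ib; apply/asboolP; apply: ID => //.
by have := IM (-1) b 1 Ib; rewrite mulr1 mulN1r.
Qed.

HB.instance Definition _ (I : Type) (f : I -> A) :=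
  GRing.isZmodClosed.Build A (ideal_pred f) (ideal_pred_zmod_closed f).

(* The library only makes the quotient by an ideal a ring when A is
   commutative, so the product and the scaling are put on it here. As it need
   not be nonzero, it is a [pzRingType] and an [lmodType K], not an [lalgType]. *)
Definition quotient_alg {I : Type} (f : I -> A) := Quotient.quot (ideal_pred f).

Section Structure.
Variables (I : Type) (f : I -> A).
Local Notation Q := (quotient_alg f).

HB.instance Definition _ := GRing.Zmodule.on Q.
HB.instance Definition _ := EqQuotient.on Q.

Definition class (a : A) : Q := \pi_Q a.

Lemma classP (a b : A) : reflect (class a = class b) (a - b \in ideal_pred f).
Proof. by rewrite Quotient.idealrBE; apply: eqP. Qed.

Lemma classD a b : class (a + b) = class a + class b.
Proof. by rewrite /class [LHS]Quotient.pi_add. Qed.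

Lemma class_repr (x : Q) : class (repr x) = x.
Proof. exact: reprK. Qed.

Lemma class_surj (x : Q) : exists a, x = class a.
Proof. by exists (repr x); rewrite class_repr. Qed.

Definition qone : Q := class 1.
Definition qmul (x y : Q) : Q := class (repr x * repr y).
Definition qscale (c : K) (x : Q) : Q := class (c *: repr x).

Lemma qmulE a b : qmul (class a) (class b) = class (a * b).
Proof.
apply/classP; set a' := repr _; set b' := repr _.
have Ia : a' - a \in ideal_pred f by apply/classP; rewrite class_repr.
have Ib : b' - b \in ideal_pred f by apply/classP; rewrite class_repr.
have -> : a' * b' - a * b = 1 * (a' - a) * b' + a * (b' - b) * 1.
  by rewrite mul1r mulr1 mulrBl mulrBr addrA subrK.
by rewrite rpredD // ideal_predM.
Qed.

Lemma qscaleE c a : qscale c (class a) = class (c *: a).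
Proof.
apply/classP; set a' := repr _.
have Ia : a' - a \in ideal_pred f by apply/classP; rewrite class_repr.
have -> : c *: a' - c *: a = c%:A * (a' - a) * 1.
  by rewrite mulr1 -scalerAl mul1r scalerBr.
exact: ideal_predM.
Qed.

Lemma qmulA : associative qmul.
Proof.
move=> x y z; have [a ->] := class_surj x; have [b ->] := class_surj y;
have [c ->] := class_surj z.
by rewrite !qmulE mulrA.
Qed.

Lemma qmul1x : left_id qone qmul.
Proof. by move=> x; have [a ->] := class_surj x; rewrite qmulE mul1r. Qed.

Lemma qmulx1 : right_id qone qmul.
Proof. by move=> x; have [a ->] := class_surj x; rewrite qmulE mulr1. Qed.

Lemma qmulDl : left_distributive qmul +%R.
Proof.
move=> x y z; have [a ->] := class_surj x; have [b ->] := class_surj y;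
have [c ->] := class_surj z.
by rewrite -classD !qmulE -classD mulrDl.
Qed.

Lemma qmulDr : right_distributive qmul +%R.
Proof.
move=> x y z; have [a ->] := class_surj x; have [b ->] := class_surj y;
have [c ->] := class_surj z.
by rewrite -classD !qmulE -classD mulrDr.
Qed.

HB.instance Definition _ := GRing.Zmodule_isPzRing.Build Q
  qmulA qmul1x qmulx1 qmulDl qmulDr.

Lemma qscaleA a b x : qscale a (qscale b x) = qscale (a * b) x.
Proof. by have [u ->] := class_surj x; rewrite !qscaleE scalerA. Qed.

Lemma qscale1 : left_id 1 qscale.
Proof. by move=> x; have [u ->] := class_surj x; rewrite qscaleE scale1r. Qed.

Lemma qscaleDr : right_distributive qscale +%R.
Proof.
move=> c x y; have [a ->] := class_surj x; have [b ->] := class_surj y.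
by rewrite -classD !qscaleE -classD scalerDr.
Qed.

Lemma qscaleDl x : {morph qscale^~ x : a b / a + b}.
Proof.
by move=> a b /=; have [u ->] := class_surj x; rewrite !qscaleE -classD scalerDl.
Qed.

HB.instance Definition _ := GRing.Zmodule_isLmodule.Build K Q
  qscaleA qscale1 qscaleDr qscaleDl.

Lemma classM a b : class (a * b) = class a * class b.
Proof. by rewrite -[LHS]qmulE. Qed.

Lemma classZ c a : class (c *: a) = c *: class a.
Proof. by rewrite -[LHS]qscaleE. Qed.

Lemma class_scaleAl (c : K) (x y : Q) : c *: (x * y) = (c *: x) * y.
Proof.
have [a ->] := class_surj x; have [b ->] := class_surj y.
by rewrite -classM -!classZ -classM scalerAl.
Qed.

End Structure.
End IdealQuotient.

Arguments class {K A I} f a.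

(* The affine space K^I over a finite index set I, with its Zariski topology:
   the open sets are the complements of the zero loci of arbitrary sets of
   polynomials, whose variables are numbered by [enum_val : 'I_#|I| -> I]. *)
Definition affine_space (K : fieldType) (I : finType) : Type := I -> K.

Section Zariski.
Context {K : fieldType} {I : finType}.
Local Notation X := (affine_space K I).
Local Notation poly := (mpoly.mpoly #|I| K).

HB.instance Definition _ := gen_eqMixin X.
HB.instance Definition _ := gen_choiceMixin X.

Definition peval (v : X) (p : poly) : K :=
  mpoly.meval (fun i => v (enum_val i)) p.

Definition nonzero_locus (S : set poly) : set X :=
  [set v | exists2 p, S p & peval v p != 0].

Definition zariski_open : set_system X :=
  [set U | exists S : set poly, U = nonzero_locus S].

Lemma zariski_openT : zariski_open setT.
Proof.
exists [set (1 : poly)]; apply/seteqP; split=> v //= _; exists 1 => //.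
by rewrite /peval rmorph1 oner_neq0.
Qed.

Lemma zariski_openI : setI_closed zariski_open.
Proof.
move=> _ _ [S ->] [T ->].
exists [set r | exists p q, [/\ S p, T q & r = p * q]].
apply/seteqP; split=> v /=.
  move=> [[p Sp pv] [q Tq qv]]; exists (p * q); first by exists p, q.
  by rewrite /peval rmorphM mulf_neq0.
move=> [_ [p [q [Sp Tq ->]]]]; rewrite /peval rmorphM mulf_eq0 negb_or.
by move=> /andP[pv qv]; split; [exists p | exists q].
Qed.

Lemma zariski_open_bigU (J : Type) (U : J -> set X) :
  (forall j, zariski_open (U j)) -> zariski_open (\bigcup_j U j).
Proof.
move=> /choice[S US]; exists (\bigcup_j S j).
apply/seteqP; split=> v.
  by move=> [j _]; rewrite US => -[p Sp pv]; exists p => //; exists j.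
by move=> [p [j _ Sp] pv]; exists j => //; rewrite US; exists p.
Qed.

HB.instance Definition _ := isOpenTopological.Build X
  zariski_openT zariski_openI zariski_open_bigU.

End Zariski.

Section Quadratic.
Context {K : fieldType} {n d : nat}.

(* Noncommutative polynomials K<x_0, ..., x_(n-1)>: the algebra of the free
   monoid of words in 'I_n. *)
Definition free_alg := monalg.malg (monalg.fmonom 'I_n) K.
HB.instance Definition _ := GRing.Lalgebra.on free_alg.

Definition gen (k : 'I_n) : free_alg := monalg.mkmalgU (monalg.fmu k) 1.

Definition homogeneous (q : nat) : set free_alg :=
  [set a | forall w, monalg.mcoeff w a != 0 -> monalg.fdeg w = q].

Definition coefs := affine_space K ('I_d * 'I_n * 'I_n)%type.

Definition relator (c : coefs) (j : 'I_d) : free_alg :=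
  \sum_(k < n) \sum_(m < n) c (j, k, m) *: (gen k * gen m).

Definition quad_alg (c : coefs) := quotient_alg (relator c).

Definition graded_piece (c : coefs) (q : nat) : set (quad_alg c) :=
  [set class (relator c) a | a in homogeneous q].
Arguments graded_piece c q : clear implicits.

Definition has_hilbert_series (c : coefs) (h : nat -> nat) : Prop :=
  forall q, has_dim (graded_piece c q) (h q).

Definition hilbert_series_poly_deg_le (D : nat) (c : coefs) : Prop :=
  exists p : {poly nat}, (size p <= D.+1)%N /\ has_hilbert_series c (fun q => p`_q).

End Quadratic.

Arguments coefs : clear implicits.
Arguments graded_piece {K n d} c q _.

(* A coefficient vector presents a quadratic algebra with d relations only if
   its d relators are linearly independent, so this is required on the dense
   open set too. *)
Definition generic_quadratic (K : fieldType) (n d : nat)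
    (P : set (coefs K n d)) : Prop :=
  exists U : set (coefs K n d),
    [/\ open U, dense U & forall c, U c -> lin_indep (relator c) /\ P c].

(* Main.v *)
From HB Require Import structures.
Require Import Defs.
From mathcomp Require Import all_boot all_order all_algebra.
From mathcomp Require Import all_classical all_reals all_analysis.
From mathcomp Require Import -(notations) monalg mpoly.
From mathcomp Require Import lra zify.

Set Implicit Arguments.
Unset Strict Implicit.
Unset Printing Implicit Defensive.

Import Order.TTheory GRing.Theory Num.Theory.
Local Open Scope classical_set_scope.
Local Open Scope ring_scope.

(** Why the theorem is true.

    A quadratic algebra R whose component R_5 vanishes has a polynomial Hilbert
    series of degree at most 4, since R is generated in degree 1 and every
    R_q is finite dimensional.  So the question is whether R_5 = 0
    generically.  This is an open condition: if all words of length 5 lie in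
    the ideal of the relators for one coefficient vector c0, fix expressions
    of these words as combinations of the s * f_j * t and let c vary in them.
    The square matrix of the coefficients of the resulting elements of degree
    5 has entries that are polynomial in c and is the identity at c0, and
    wherever its determinant does not vanish all words of length 5 lie in the
    ideal ([generic_words_ideal]).  Linear independence of the relators is
    open for the same reason ([generic_lin_indep]), and over an infinite field
    a nonempty set f <> 0, with f polynomial, is dense.

    It remains to exhibit, for large n, one algebra with n generators, d_n
    relations and R_5 = 0.  The seed is the algebra with generators x, y, z
    and relations

      x z = x x,   y z = y y,   z z = x y + y x,

    whose component of degree 5 vanishes over every ring of coefficients
    ([word5_eq0]).  Its ratio 3 / 3^2 of relations to squared generators is
    exactly the 1/3 of the theorem, where the Golod-Shafarevich series
    1 / (1 - 3 t + 3 t^2) = 1 + 3 t + 6 t^2 + 9 t^3 + 9 t^4 + 0 t^5 + ...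
    first reaches 0 in degree 5.  The seed is blown up: each letter is
    replaced by N indexed copies and each relation by the N^2 relations in
    which the two positions carry arbitrary indices.  A word in the copies is
    a word in x, y, z together with an independent index at each position, so
    the vanishing of R_5 is inherited ([witness_words_ideal]), and the ratio
    stays 3 N^2 / (3 N)^2.  Taking N = n %/ 3 + 1 and sending the superfluous
    copies to 0 yields n generators and 3 N^2 = n^2 / 3 + O(n) relations,
    which is below d_n for large n ([eventually_three_blocks]); the remaining
    relators may be taken to be 0. *)

(** * Three quadratic relations that kill all words of length 5 *)

(** The relations act on an abelian group instead of holding in a ring.  Right
    multiplication of an identity is then its application to another argument,
    and the result applies to operators that are not multiplications, such as
    those that also shift the indices of a blow-up. *)
Definition nil_relations (M : zmodType) (x y z : M -> M) :=
  [/\ forall u, x (z u) = x (x u), forall u, y (z u) = y (y u)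
    & forall u, z (z u) = x (y u) + y (x u)].

Lemma nil_relationsC (M : zmodType) (x y z : M -> M) :
  nil_relations x y z -> nil_relations y x z.
Proof. by move=> [xz yz zz]; split=> // u; rewrite addrC. Qed.

Section LowDegree.
Context {M : zmodType} {x y z : {additive M -> M}}.
Hypothesis rel_xyz : nil_relations x y z.

Let xz u : x (z u) = x (x u). Proof. by case: rel_xyz. Qed.
Let yz u : y (z u) = y (y u). Proof. by case: rel_xyz. Qed.
Let zz u : z (z u) = x (y u) + y (x u). Proof. by case: rel_xyz. Qed.

(** The overlap x z z, reduced in two ways. *)
Lemma rel_xxx u : x (x (x u)) = x (x (y u)) + x (y (x u)).
Proof. by rewrite -raddfD -zz !xz. Qed.

(** [rel_xxx] multiplied on the right by x and by z has the same left side. *)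
Lemma rel_xxyx u : x (x (y (x u))) = x (x (y (y u))).
Proof.
have := rel_xxx (z u); rewrite !xz !yz => h.
by apply: (addIr (x (y (x (x u))))); rewrite -(rel_xxx (x u)) h.
Qed.

(** [rel_xxx] multiplied by x on the right and on the left has the same left
    side. *)
Lemma rel_xyxx u : x (y (x (x u))) = x (x (x (y u))).
Proof.
apply: (addrI (x (x (y (x u))))); rewrite -(rel_xxx (x u)).
by rewrite addrC -raddfD -rel_xxx.
Qed.

(** The overlap z z z, reduced in two ways. *)
Lemma rel_zxy u : z (x (y u)) + z (y (x u)) = x (y (y u)) + y (x (x u)).
Proof. by rewrite -raddfD -zz zz xz yz. Qed.

End LowDegree.

Section WordsFromX.
Context {M : zmodType} {x y z : {additive M -> M}}.
Hypothesis rel_xyz : nil_relations x y z.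
Let rel_yxz := nil_relationsC rel_xyz.

Let xz u : x (z u) = x (x u). Proof. by case: rel_xyz. Qed.
Let yz u : y (z u) = y (y u). Proof. by case: rel_xyz. Qed.

Definition xy_letter b := if b then x else y.

(** Multiplying [rel_xxyx] on the right by x, y and z makes the four words
    x x y ? ? equal to one element p, and x x times [rel_xxx] for y then reads
    p = p + p. *)
Lemma xxy_eq0 b1 b2 u : x (x (y (xy_letter b1 (xy_letter b2 u)))) = 0.
Proof.
have xxyxx v : x (x (y (x (x v)))) = x (x (y (y (y v)))).
  by have := rel_xxyx rel_xyz (z v); rewrite !(xz, yz).
have xxyyy v : x (x (y (y (y v)))) = 0.
  apply: (addrI (x (x (y (y (y v)))))); rewrite addr0 [in RHS](rel_xxx rel_yxz).
  by rewrite !raddfD -(rel_xxyx rel_xyz (x v)) xxyxx (rel_xxyx rel_xyz).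
case: b1; case: b2; rewrite /=.
- by rewrite xxyxx xxyyy.
- by rewrite (rel_xxyx rel_xyz) xxyyy.
- by rewrite -(rel_xxyx rel_xyz) xxyxx xxyyy.
- exact: xxyyy.
Qed.

(** Each vanishing word is read off from a previous one through a relation of
    degree 3 or 4 for x or for y. *)
Lemma x_word5_eq0 b1 b2 b3 b4 u :
  x (xy_letter b1 (xy_letter b2 (xy_letter b3 (xy_letter b4 u)))) = 0.
Proof.
have xxyxx v := xxy_eq0 true true v; have xxyxy v := xxy_eq0 true false v.
have xxyyx v := xxy_eq0 false true v; have xxyyy v := xxy_eq0 false false v.
rewrite /= in xxyxx xxyxy xxyyx xxyyy.
have xxxxy v : x (x (x (x (y v)))) = 0 by rewrite -(rel_xyxx rel_xyz) xxyxx.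
have xxxyy v : x (x (x (y (y v)))) = 0.
  by have := xxxxy v; rewrite (rel_xxx rel_xyz (y v)) raddfD /= xxyxy addr0.
have xyxxx v : x (y (x (x (x v)))) = 0.
  by have := rel_xyxx rel_xyz (z v); rewrite !xz yz xxxyy.
have xxxxx v : x (x (x (x (x v)))) = 0.
  by rewrite (rel_xxx rel_xyz (x (x v))) xxyxx xyxxx addr0.
have xxxyx v : x (x (x (y (x v)))) = 0.
  by have := xxxxx v; rewrite (rel_xxx rel_xyz v) !raddfD /= xxxxy add0r.
have xyxxy v : x (y (x (x (y v)))) = 0 by rewrite (rel_xyxx rel_xyz).
have xyxyx v : x (y (x (y (x v)))) = 0.
  have := rel_xxx rel_xyz (y (x v)).
  by rewrite xxxyx xxyyx add0r.
have xyxyy v : x (y (x (y (y v)))) = 0.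
  have := rel_xxx rel_xyz (y (y v)).
  by rewrite xxxyy xxyyy add0r.
have xyyyx v : x (y (y (y (x v)))) = 0 by rewrite -(rel_xyxx rel_yxz).
have xyyxx v : x (y (y (x (x v)))) = 0.
  by have := xyyyx v; rewrite (rel_xxx rel_yxz (x v)) raddfD /= xyxyx addr0.
have xyyxy v : x (y (y (x (y v)))) = 0 by rewrite (rel_xxyx rel_yxz).
have xyyyy v : x (y (y (y (y v)))) = 0.
  by rewrite (rel_xxx rel_yxz (y v)) raddfD /= xyyxy xyxyy addr0.
by case: b1; case: b2; case: b3; case: b4.
Qed.

End WordsFromX.

Section AnticommutationAfterZ.
Context {M : zmodType} {x y z : {additive M -> M}}.
Hypothesis rel_xyz : nil_relations x y z.
Let rel_yxz := nil_relationsC rel_xyz.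

Let zz u : z (z u) = x (y u) + y (x u). Proof. by case: rel_xyz. Qed.

Let xy := @xy_letter M x y.

Lemma y_word5_eq0 b1 b2 b3 b4 u : y (xy b1 (xy b2 (xy b3 (xy b4 u)))) = 0.
Proof.
have := x_word5_eq0 rel_yxz (~~ b1) (~~ b2) (~~ b3) (~~ b4) u.
by case: b1; case: b2; case: b3; case: b4.
Qed.

(** The right side of [rel_zxy] begins with x or y, hence vanishes in
    degree 5. *)
Lemma zxy_anticomm b1 b2 u :
  z (x (y (xy b1 (xy b2 u)))) = - z (y (x (xy b1 (xy b2 u)))).
Proof.
apply/eqP; rewrite -addr_eq0 (rel_zxy rel_xyz).
by rewrite (x_word5_eq0 rel_xyz false false) (y_word5_eq0 true true) addr0.
Qed.

(** This is z times [rel_zxy]: on its left side z z becomes x y + y x, and then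
    all words begin with x or y. *)
Lemma zxyy_anticomm b u : z (x (y (y (xy b u)))) = - z (y (x (x (xy b u)))).
Proof.
apply/eqP; rewrite -addr_eq0 -raddfD -(rel_zxy rel_xyz) raddfD !zz.
rewrite (x_word5_eq0 rel_xyz false true false).
rewrite (x_word5_eq0 rel_xyz false false true).
rewrite (y_word5_eq0 true true false) (y_word5_eq0 true false true).
by rewrite !addr0.
Qed.

(** Both anticommutation rules rewrite z x y y x, which gives
    z y x x x = z y x y x, whereas [rel_xxx] says that
    z y x x x = z y x x y + z y x y x. *)
Lemma zyxxy_eq0 u : z (y (x (x (y u)))) = 0.
Proof.
apply: (addIr (z (y (x (y (x u)))))); rewrite add0r.
rewrite -2!raddfD -(rel_xxx rel_xyz).
have /= := zxy_anticomm false true u; have /= := zxyy_anticomm true u.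
by move=> -> /oppr_inj.
Qed.
End AnticommutationAfterZ.

Section WordsFromZ.
Context {M : zmodType} {x y z : {additive M -> M}}.
Hypothesis rel_xyz : nil_relations x y z.
Let rel_yxz := nil_relationsC rel_xyz.

Let xy := @xy_letter M x y.

Lemma zx_word5_eq0 b1 b2 b3 u : z (x (xy b1 (xy b2 (xy b3 u)))) = 0.
Proof.
have zyxxy v : z (y (x (x (y v)))) = 0 := zyxxy_eq0 rel_xyz v.
have zxyyx v : z (x (y (y (x v)))) = 0 := zyxxy_eq0 rel_yxz v.
have zxyyy v : z (x (y (y (y v)))) = 0.
  by have /= -> := zxyy_anticomm rel_xyz false v; rewrite zyxxy oppr0.
have zxyxy v : z (x (y (x (y v)))) = 0.
  by have /= -> := zxy_anticomm rel_xyz true false v; rewrite zyxxy oppr0.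
have zxyxx v : z (x (y (x (x v)))) = 0.
  have /= -> := zxy_anticomm rel_xyz true true v.
  by have /= <- := zxyy_anticomm rel_xyz true v.
have zxxxy v : z (x (x (x (y v)))) = 0 by rewrite -(rel_xyxx rel_xyz).
have zxxyy v : z (x (x (y (y v)))) = 0.
  by have := zxxxy v; rewrite (rel_xxx rel_xyz (y v)) raddfD /= zxyxy addr0.
have zxxyx v : z (x (x (y (x v)))) = 0 by rewrite (rel_xxyx rel_xyz).
have zxxxx v : z (x (x (x (x v)))) = 0.
  by rewrite (rel_xxx rel_xyz (x v)) raddfD /= zxxyx zxyxx addr0.
by case: b1; case: b2; case: b3.
Qed.
End WordsFromZ.

Section AllWords.
(* [None] stands for z, [Some true] for x and [Some false] for y. *)
Context {M : zmodType} (l : option bool -> {additive M -> M}).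
Hypothesis rel_l : nil_relations (l (Some true)) (l (Some false)) (l None).

(** The relations eliminate every z except one in first position. *)
Lemma word5_eq0 p1 p2 p3 p4 p5 u : l p1 (l p2 (l p3 (l p4 (l p5 u)))) = 0.
Proof.
have [xz yz zz] := rel_l; have rel_l' := nil_relationsC rel_l.
have x0 := x_word5_eq0 rel_l; have y0 := y_word5_eq0 rel_l.
have z0 b b1 b2 b3 v :
    l None (l (Some b) (l (Some b1) (l (Some b2) (l (Some b3) v)))) = 0.
  case: b.
    have := zx_word5_eq0 rel_l b1 b2 b3 v.
    by case: b1; case: b2; case: b3.
  have := zx_word5_eq0 rel_l' (~~ b1) (~~ b2) (~~ b3) v.
  by case: b1; case: b2; case: b3.
have s0 b b1 b2 b3 b4 v :
    l (Some b) (l (Some b1) (l (Some b2) (l (Some b3) (l (Some b4) v)))) = 0.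
  have := y0 b1 b2 b3 b4 v; have := x0 b1 b2 b3 b4 v.
  by case: b; case: b1; case: b2; case: b3; case: b4.
by move: p1 p2 p3 p4 p5 => [[]|] [[]|] [[]|] [[]|] [[]|];
  rewrite ?(xz, yz, zz, raddfD) /= ?(xz, yz, zz, raddfD) /= ?(z0, s0) ?addr0.
Qed.
End AllWords.

(** * Polynomial functions and the density of their nonvanishing sets *)

Section Zariski.
Context {K : fieldType} {I : finType}.
Implicit Types (v w : affine_space K I) (p : mpoly.mpoly #|I| K).

(** The restriction of p to the line through v and w, which passes through v
    at time 0 and through w at time 1. *)
Definition line_restr v w p : {poly K} :=
  mpoly.mmap polyC
    (fun i => (v (enum_val i))%:P + (w (enum_val i) - v (enum_val i)) *: 'X) p.

Lemma line_restrE v w p t :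
  (line_restr v w p).[t] = peval (fun i => v i + (w i - v i) * t) p.
Proof.
rewrite /peval mpoly.mevalE /line_restr /mpoly.mmap horner_sum.
apply: eq_bigr => m _; rewrite hornerM hornerC /mpoly.mmap1 horner_prod.
congr (_ * _); apply: eq_bigr => i _.
by rewrite horner_exp !hornerE.
Qed.

(** A nonempty open set contains a point v where some polynomial q does not
    vanish.  On the line through v and w both p and q restrict to nonzero
    polynomials in one variable, and the infinite field contains a point that
    is a root of neither. *)
Lemma dense_nonzero_locus p w : infinite_set [set: K] -> peval w p != 0 ->
  dense (nonzero_locus [set p] : set (affine_space K I)).
Proof.
move=> Kinf pw O [v Ov] [S OE]; move: Ov; rewrite OE => -[q Sq qv].
pose f := line_restr v w p * line_restr v w q.
have f_neq0 : f != 0.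
  rewrite mulf_neq0 //; apply/eqP.
    move=> /(congr1 (fun g => g.[1])); rewrite line_restrE horner0 => p0.
    move/eqP: pw; apply; rewrite -p0; congr peval; apply/funext => i.
    by rewrite mulr1 addrC subrK.
  move=> /(congr1 (fun g => g.[0])); rewrite line_restrE horner0 => q0.
  move/eqP: qv; apply; rewrite -q0; congr peval; apply/funext => i.
  by rewrite mulr0 addr0.
have [t ft] : exists t, ~~ root f t.
  apply: contrapT => /forallNP fr.
  have [B _] := infinite_set_fset (size f) Kinf; rewrite leqNgt => /negP; apply.
  apply: (max_poly_roots f_neq0); last exact: finmap.fset_uniq.
  by apply/allP => t _; apply: contrapT => /negP /fr.
move: ft; rewrite rootE hornerM !line_restrE mulf_eq0 negb_or => /andP[pt qt].
by exists (fun i => v i + (w i - v i) * t); split; [exists q|exists p].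
Qed.

Definition polynomial_fun (f : affine_space K I -> K) :=
  exists p, forall v, peval v p = f v.

Lemma polynomial_cst k : polynomial_fun (fun=> k).
Proof. by exists (mpoly.mpolyC _ k) => v; rewrite /peval mpoly.mevalC. Qed.

Lemma polynomial_coord i : polynomial_fun (fun v => v i).
Proof.
exists (mpoly.mpolyX K (mpoly.mnm1 (enum_rank i))) => v.
by rewrite /peval mpoly.mevalXU enum_rankK.
Qed.

Lemma polynomialM f g :
  polynomial_fun f -> polynomial_fun g -> polynomial_fun (f \* g).
Proof.
move=> [p pf] [q qg]; exists (p * q) => v; rewrite /peval rmorphM.
by congr (_ * _); [apply: pf | apply: qg].
Qed.

Lemma polynomial_sum (J : Type) (r : seq J) (P : pred J) F :
  (forall j, polynomial_fun (F j)) ->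
  polynomial_fun (fun v => \sum_(j <- r | P j) F j v).
Proof.
move=> /choice[p pF]; exists (\sum_(j <- r | P j) p j) => v.
by rewrite /peval rmorph_sum; apply: eq_bigr => j _; apply: pF.
Qed.

Lemma polynomial_prod (J : Type) (r : seq J) (P : pred J) F :
  (forall j, polynomial_fun (F j)) ->
  polynomial_fun (fun v => \prod_(j <- r | P j) F j v).
Proof.
move=> /choice[p pF]; exists (\prod_(j <- r | P j) p j) => v.
by rewrite /peval rmorph_prod; apply: eq_bigr => j _; apply: pF.
Qed.

Lemma polynomial_det m (A : affine_space K I -> 'M[K]_m) :
  (forall i j, polynomial_fun (fun v => A v i j)) ->
  polynomial_fun (fun v => \det (A v)).
Proof.
move=> polA; apply: polynomial_sum => s.
by apply: polynomialM; [apply: polynomial_cst | apply: polynomial_prod].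
Qed.

Lemma open_dense_polynomial_neq0 f w :
  infinite_set [set: K] -> polynomial_fun f -> f w != 0 ->
  open [set v | f v != 0] /\ dense [set v | f v != 0].
Proof.
move=> Kinf [p pf] fw.
have -> : [set v | f v != 0] = nonzero_locus [set p].
  apply/seteqP; split=> v /=; first by exists p; rewrite ?pf.
  by move=> [_ ->]; rewrite pf.
split; first by exists [set p].
by apply: (@dense_nonzero_locus p w) => //; rewrite pf.
Qed.
End Zariski.

(** * Counting relations when the lower limit exceeds 1/3 *)

Lemma limn_einf_gt (R : realType) (u : (\bar R)^nat) (r : R) :
  (r%:E < limn_einf u)%E ->
  exists2 e : R, 0 < e &
    exists n0, forall n, (n0 <= n)%N -> ((r + e)%:E <= u n)%E.
Proof.
rewrite limn_einf_lim (cvg_lim _ (@cvg_einfs_sup _ u)) //.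
move=> /ereal_sup_gt[_ [n0 _ <-] ru].
have lb n : (n0 <= n)%N -> (einfs u n0 <= u n)%E.
  by move=> n0n; apply: ereal_inf_lbound; exists n.
case: (einfs u n0) ru lb => [l| |] ru lb.
- exists (l - r); first by rewrite subr_gt0 -lte_fin.
  by exists n0 => n /lb; rewrite addrC subrK.
- exists 1 => //; exists n0 => n /lb; rewrite leye_eq => /eqP ->; exact: leey.
- by rewrite ltNge leNye in ru.
Qed.

(** Three blocks of b = n %/ 3 + 1 letters suffice for n letters, and their
    3 b^2 relations number at most (n + 3)^2 / 3, which exceeds n^2 / 3 only by
    a linear term. *)
Lemma eventually_three_blocks (R : realType) (d : nat -> nat) :
  ((3%:R^-1 : R)%:E < limn_einf (fun n => ((d n)%:R / n%:R ^+ 2 : R)%:E))%E ->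
  exists n0, forall n, (n0 <= n)%N ->
    (0 < n)%N /\ (3 * (n %/ 3).+1 ^ 2 <= d n)%N.
Proof.
move=> /limn_einf_gt[e e_gt0 [n1 dn]].
(* For 5 <= e * n and 1 <= n one has 2 * n + 3 <= 5 * n <= e * n ^ 2. *)
have [m em] : exists m : nat, 5 / e < m%:R.
  exists (Num.bound (5 / e)); apply: archi_boundP.
  by rewrite divr_ge0 // ltW.
exists (maxn n1 m.+1) => n; rewrite geq_max => /andP[n1n mn].
have n_gt0 : (0 < n)%N by apply: leq_ltn_trans mn.
split=> //; have := dn n n1n; rewrite lee_fin.
have nR_gt0 : 0 < n%:R :> R by rewrite ltr0n.
rewrite ler_pdivlMr ?exprn_gt0 // => le_d.
set b := (n %/ 3).+1.
have b3 : (3 * b <= n + 3)%N by rewrite /b; lia.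
have {}b3 : 3 * b%:R <= n%:R + 3 :> R.
  by rewrite -(natrM _ 3) -(natrD _ n 3) ler_nat.
have en : 5 <= e * n%:R.
  rewrite mulrC -ler_pdivrMr // ltW // (lt_trans em) // ltr_nat //.
have n1' : 1 <= n%:R :> R by rewrite (ler_nat _ 1).
have b0 : 0 <= b%:R :> R by [].
rewrite -(ler_nat R) natrM natrX; apply: le_trans le_d.
have : (3 * b%:R) ^+ 2 <= (n%:R + 3) ^+ 2 :> R.
  by rewrite lerXn2r // nnegrE; nra.
nra.
Qed.

(** * The free algebra and its words *)

HB.lock Definition word (K : fieldType) (n : nat) (s : seq 'I_n) :
  @free_alg K n := monalg.mkmalgU (monalg.FMonom s) 1.
Canonical word_unlockable := Unlockable word.unlock.
Arguments word {K n} s.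

Section Words.
Context {K : fieldType} {n : nat}.
Local Notation A := (@free_alg K n).
Local Notation word := (@word K n).
Implicit Types (s t : seq 'I_n) (a b : A).

Definition wcoef s a : K := monalg.mcoeff (monalg.FMonom s) a.

Lemma wcoef_is_linear s : scalar (wcoef s).
Proof. by move=> k a b; rewrite /wcoef monalg.mcoeffD monalg.mcoeffZ. Qed.

HB.instance Definition _ s :=
  GRing.isLinear.Build K A K _ (wcoef s) (wcoef_is_linear s).

Lemma wcoef0 s : wcoef s 0 = 0.
Proof. exact: raddf0. Qed.

Lemma wcoefZ s k a : wcoef s (k *: a) = k * wcoef s a.
Proof. exact: monalg.mcoeffZ. Qed.

Lemma wcoef_sum s (J : Type) (r : seq J) (P : pred J) (F : J -> A) :
  wcoef s (\sum_(j <- r | P j) F j) = \sum_(j <- r | P j) wcoef s (F j).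
Proof. exact: raddf_sum. Qed.

Lemma wcoef_word s t : wcoef s (word t) = (t == s)%:R.
Proof. by rewrite /wcoef unlock monalg.mcoeffU1 -val_eqE. Qed.

Lemma wordM s t : word s * word t = word (s ++ t).
Proof.
rewrite unlock monalg.malgM_def monalg.fgmulUU mulr1.
by congr monalg.mkmalgU; apply: val_inj; rewrite /= monalg.fmM.
Qed.

Lemma word1 : word [::] = 1.
Proof.
by rewrite unlock; congr monalg.mkmalgU; apply: val_inj; rewrite /= monalg.fm1.
Qed.

Lemma genE k : gen k = word [:: k].
Proof. by rewrite unlock; congr monalg.mkmalgU; rewrite monalg.fmuE. Qed.

Lemma free_algP a b : (forall s, wcoef s a = wcoef s b) -> a = b.
Proof. by move=> ab; apply/monalg.malgP => -[s]; apply: ab. Qed.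

Lemma scale_word (k : K) s : k *: word s = monalg.mkmalgU (monalg.FMonom s) k.
Proof.
apply: free_algP => t; rewrite wcoefZ [in LHS]wcoef_word.
by rewrite /wcoef monalg.mcoeffU mulr_natr -val_eqE.
Qed.

Lemma free_alg_ind (P : A -> Prop) :
  P 0 -> (forall a b, P a -> P b -> P (a + b)) ->
  (forall k s, P (k *: word s)) -> forall a, P a.
Proof.
move=> P0 PD PW a; rewrite [a]monalg.monalgE; apply: big_ind => // -[s] _.
by have := PW (wcoef s a) s; rewrite scale_word.
Qed.

Lemma word_mulZ (k : K) s t : word s * (k *: word t) = k *: word (s ++ t).
Proof.
rewrite 2!scale_word -[word s]scale1r scale_word.
rewrite monalg.malgM_def monalg.fgmulUU mul1r.
by congr monalg.mkmalgU; apply: val_inj; rewrite /= monalg.fmM.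
Qed.

Lemma free_alg_scaleAr (k : K) a b : a * (k *: b) = k *: (a * b).
Proof.
elim/free_alg_ind: a => [|a1 a2 IH1 IH2|c s]; first by rewrite !mul0r scaler0.
  by rewrite !mulrDl IH1 IH2 scalerDr.
rewrite -!scalerAl scalerA mulrC -scalerA; congr (_ *: _).
elim/free_alg_ind: b => [|b1 b2 IH1 IH2|m t].
  by rewrite !(scaler0, mulr0).
  rewrite scalerDr mulrDr [in RHS]mulrDr scalerDr.
  exact: (congr2 +%R IH1 IH2).
by rewrite [in LHS]scalerA [LHS]word_mulZ [in RHS]word_mulZ scalerA.
Qed.

Lemma homogeneousE q a : homogeneous q a ->
  a = \sum_(s : q.-tuple 'I_n) wcoef s a *: word s.
Proof.
move=> hom_a; apply: free_algP => s; rewrite wcoef_sum.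
under eq_bigr do rewrite wcoefZ wcoef_word.
have [sq | sNq] := eqVneq (size s) q; last first.
  rewrite big1 => [|t _]; last first.
    have /negPf -> : tval t != s.
      by apply: contraNneq sNq => <-; rewrite size_tuple.
    by rewrite mulr0.
  apply/eqP; apply: contraNT sNq => as_neq0.
  by rewrite -(hom_a (monalg.FMonom s) as_neq0).
rewrite -sq in hom_a *; rewrite (bigD1 (in_tuple s)) //= eqxx mulr1.
rewrite big1 ?addr0 // => t /negPf ts.
by rewrite -[s]/(val (in_tuple s)) val_eqE ts mulr0.
Qed.

Lemma word_homogeneous s : homogeneous (size s) (word s).
Proof.
move=> [t]; rewrite -[monalg.mcoeff _ _]/(wcoef t (word s)) wcoef_word.
by case: (s =P t) => [->|_] //; rewrite eqxx.
Qed.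
End Words.

(** * Graded pieces and their dimensions *)

Lemma two_sided_ideal_lincomb (K : fieldType) (A : lalgType K) (J : set A)
    (T : Type) (r : seq T) (k : T -> K) (F : T -> A) :
  two_sided_ideal J -> (forall t, J (F t)) -> J (\sum_(t <- r) k t *: F t).
Proof.
move=> [J0 JD JM] JF; apply: big_ind => // t _.
by rewrite -[F t]mul1r -[1 * F t]mulr1 !scalerAl; apply: JM.
Qed.

(** A spanning family of least size is a basis: a vector with a nonzero
    coefficient in a linear relation could be left out. *)
Lemma spanned_has_dim (K : fieldType) (V : lmodType K) (W : set V) m
    (v : 'I_m -> V) :
  (forall i, W (v i)) ->
  (forall x, W x -> exists a : 'I_m -> K, x = \sum_i a i *: v i) ->
  exists k, has_dim W k.
Proof.
pose spans k := exists2 b : 'I_k -> V, forall i, W (b i)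
  & forall x, W x -> exists a : 'I_k -> K, x = \sum_i a i *: b i.
move=> Wv spanv; have [|k] := @ex_minnP (fun k => `[< spans k >]).
  by exists m; apply/asboolP; exists v.
move=> /asboolP[b Wb spanb] min_k; exists k, b; split=> // a ab0 i0.
apply: contrapT => /eqP ai0; suff : (k <= k.-1)%N.
  by case: k i0 {min_k b Wb spanb a ab0 ai0} => [[]//|k] _; rewrite ltnn.
apply: min_k; apply/asboolP.
case: k i0 => [[]//|k] i0 in a b Wb spanb ab0 ai0 *.
exists (b \o lift i0) => [i|x /spanb[c ->]]; first exact: Wb.
exists (fun i => c (lift i0 i) - c i0 / a i0 * a (lift i0 i)).
have bi0 : b i0 = - (a i0)^-1 *: \sum_i a (lift i0 i) *: b (lift i0 i).
  move: ab0; rewrite (bigD1_ord i0) //= addrC => /eqP.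
  rewrite addr_eq0 => /eqP ->.
  by rewrite scaleNr scalerN opprK scalerA mulVf // scale1r.
rewrite (bigD1_ord i0) //= bi0 scalerA scaler_sumr -big_split /=.
apply: eq_bigr => i _; rewrite scalerA -scalerDl; congr (_ *: _).
by rewrite addrC mulrN mulNr.
Qed.

Section HilbertSeries.
Context {K : fieldType} {n d : nat} (c : coefs K n d).
Local Notation f := (relator c).

Lemma class0 : class f 0 = 0.
Proof. by apply: (addrI (class f 0)); rewrite -classD !addr0. Qed.

Lemma class_eq0 (a : free_alg) : class f a = 0 <-> ideal_generated f a.
Proof.
rewrite -class0; split=> [/classP|Ia]; first by rewrite subr0 => /asboolP.
by apply/classP; rewrite subr0; apply/asboolP.
Qed.

Lemma class_congr a b : ideal_generated f (a - b) -> class f a = class f b.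
Proof. by move=> Iab; apply/classP/asboolP. Qed.

Lemma class_sum (J : Type) (r : seq J) (P : pred J) F :
  class f (\sum_(j <- r | P j) F j) = \sum_(j <- r | P j) class f (F j).
Proof. by apply: (big_morph (class f) (classD f) class0). Qed.

Lemma graded_piece_has_dim q : exists k, has_dim (graded_piece c q) k.
Proof.
pose w (i : 'I_#|{: q.-tuple 'I_n}|) := word (enum_val i) : @free_alg K n.
apply: (@spanned_has_dim _ _ _ _ (fun i => class f (w i))) => [i|_ [a qa <-]].
  exists (w i) => //; rewrite -[X in homogeneous X](size_tuple (enum_val i)).
  exact: word_homogeneous.
exists (fun i : 'I_#|{: q.-tuple 'I_n}| => wcoef (enum_val i) a).
rewrite {1}(homogeneousE qa) class_sum.
rewrite (reindex _ (onW_bij _ (enum_val_bij _))) /=.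
by apply: eq_bigr => i _; rewrite classZ.
Qed.

(** Words longer than D + 1 have a prefix of length D + 1, so their classes
    vanish as well. *)
Lemma hilbert_series_of_words D :
  (forall w : (D.+1).-tuple 'I_n, ideal_generated f (word w)) ->
  hilbert_series_poly_deg_le D c.
Proof.
move=> word_ideal; have [h hP] := choice graded_piece_has_dim.
exists (\poly_(i < D.+1) h i); split; first exact: size_poly.
move=> q; rewrite coef_poly; case: ltnP => [//|Dq].
exists (fun=> 0); split=> [[]//|a _ []//|_ [a qa <-]].
exists (fun=> 0); rewrite big_ord0; apply/class_eq0.
rewrite (homogeneousE qa).
apply: (two_sided_ideal_lincomb _ _ (ideal_generatedP _)).
have [_ _ IM] := ideal_generatedP f; move=> s.
have sz : size (take D.+1 s) = D.+1 by rewrite size_takel // size_tuple.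
have := IM 1 _ (word (drop D.+1 s)) (word_ideal (Tuple (introT eqP sz))).
by rewrite mul1r wordM cat_take_drop.
Qed.
End HilbertSeries.

(** * Vanishing in one degree and linear independence are open conditions *)

(** A subspace S becomes stable under products when only those elements are
    kept whose translates by the spanning set W, on both sides, stay in S. *)
Lemma two_sided_ideal_conductor (K : fieldType) (A : lalgType K) (W S : set A) :
  (forall P : A -> Prop, P 0 -> (forall a b, P a -> P b -> P (a + b)) ->
    (forall k w, W w -> P (k *: w)) -> forall a, P a) ->
  (forall (k : K) (a b : A), a * (k *: b) = k *: (a * b)) ->
  (forall u v, W u -> W v -> W (u * v)) ->
  S 0 -> (forall a b, S a -> S b -> S (a + b)) ->
  (forall k a, S a -> S (k *: a)) ->
  two_sided_ideal [set a | forall u v, W u -> W v -> S (u * a * v)].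
Proof.
move=> indW scaleAr WM S0 SD SZ.
split=> [u v _ _|a b Sa Sb u v Wu Wv|b a c Sa u v Wu Wv].
- by rewrite mulr0 mul0r.
- by rewrite mulrDr mulrDl; apply: SD; [apply: Sa | apply: Sb].
elim/indW: b => [|b b' Sb Sb'|k b Wb].
- by rewrite !(mul0r, mulr0).
- by rewrite !mulrDl mulrDr mulrDl; apply: SD.
elim/indW: c => [|c c' Sc Sc'|k' c Wc].
- by rewrite !(mul0r, mulr0).
- by rewrite !mulrDr mulrDl; apply: SD.
rewrite !scaleAr -!scalerAl !scaleAr -!scalerAl; apply/SZ/SZ.
by rewrite !mulrA -(mulrA _ c v); apply: Sa; apply: WM.
Qed.

Section Combinations.
Context {K : fieldType} {n d : nat}.
Implicit Types (c : coefs K n d) (s t w : seq 'I_n).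

Lemma homogeneousP q (a : @free_alg K n) :
  homogeneous q a <-> forall s, size s != q -> wcoef s a = 0.
Proof.
split=> [hom_a s|a0 [s] as_neq0].
  by apply: contraNeq => as_neq0; rewrite -(hom_a (monalg.FMonom s) as_neq0).
by apply/eqP; apply: contraNT as_neq0 => /a0/eqP.
Qed.

Lemma translate_relatorE c s j t : word s * relator c j * word t =
  \sum_(k < n) \sum_(m < n) c (j, k, m) *: word (s ++ [:: k, m & t]).
Proof.
rewrite mulr_sumr mulr_suml; apply: eq_bigr => k _.
rewrite mulr_sumr mulr_suml; apply: eq_bigr => m _.
by rewrite free_alg_scaleAr -scalerAl !genE !wordM -!catA.
Qed.

Lemma wcoef_translate_relator c w s j t :
  wcoef w (word s * relator c j * word t) =
  \sum_(k < n) \sum_(m < n) c (j, k, m) * (s ++ [:: k, m & t] == w)%:R.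
Proof.
rewrite translate_relatorE wcoef_sum; apply: eq_bigr => k _.
by rewrite wcoef_sum; apply: eq_bigr => m _; rewrite wcoefZ wcoef_word.
Qed.

Lemma wcoef_relator c j k m : wcoef [:: k; m] (relator c j) = c (j, k, m).
Proof.
rewrite -[relator c j]mul1r -[_ * _]mulr1 -word1 wcoef_translate_relator.
rewrite (bigD1 k) //= (bigD1 m) //= eqxx mulr1 !big1 ?addr0 //.
- move=> k' /negPf k'k; rewrite big1 // => m' _.
  by rewrite eqseq_cons k'k mulr0.
- by move=> m' /negPf m'm; rewrite !eqseq_cons m'm andbF mulr0.
Qed.

Local Notation term := (K * seq 'I_n * 'I_d * seq 'I_n)%type.

Definition translate c (l : term) : free_alg :=
  let: (_, s, j, t) := l in word s * relator c j * word t.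

(** The data L do not mention c: the same formal combination can be evaluated
    at any coefficient vector. *)
Definition combination c (L : seq term) : free_alg :=
  \sum_(l <- L) l.1.1.1 *: translate c l.

Definition of_degree q (l : term) : bool :=
  let: (_, s, _, t) := l in (size s + size t).+2 == q.

Lemma combination_ideal c L : ideal_generated (relator c) (combination c L).
Proof.
apply: (two_sided_ideal_lincomb _ _ (ideal_generatedP _)).
have [_ _ IM] := ideal_generatedP (relator c).
by move=> [[[k s] j] t]; apply: IM => J _; apply.
Qed.

Lemma combination_homogeneous q c L :
  all (of_degree q) L -> homogeneous q (combination c L).
Proof.
move=> /allP degL; apply/homogeneousP => w wq.
rewrite /combination wcoef_sum big_seq big1 // => -[[[k s] j] t].
move=> /degL /= /eqP stq.
rewrite wcoefZ wcoef_translate_relator !big1 ?mulr0 // => k' _.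
rewrite big1 // => m _; case: eqVneq => [ew|_]; rewrite ?mulr0 //.
by move: wq; rewrite -ew size_cat /= !addnS stq eqxx.
Qed.

(** The elements that agree in degree q with a combination of translates of
    degree q form a subspace S.  Its conductor by words is an ideal that
    contains the relators, because a translate of a relator is homogeneous,
    hence is itself such a combination or has no component in degree q. *)
Lemma ideal_combination q c a :
  ideal_generated (relator c) a -> homogeneous q a ->
  exists2 L, all (of_degree q) L & combination c L = a.
Proof.
pose S := [set a | exists2 L, all (of_degree q) L
  & forall w, size w = q -> wcoef w (combination c L) = wcoef w a].
have S0 : S 0 by exists [::] => // w _; rewrite /combination big_nil.
have SD a1 a2 : S a1 -> S a2 -> S (a1 + a2).
  move=> [L1 dL1 L1a] [L2 dL2 L2a]; exists (L1 ++ L2).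
    by rewrite all_cat dL1.
  by move=> w wq; rewrite /combination big_cat !linearD /= -L1a // -L2a.
have SZ k a1 : S a1 -> S (k *: a1).
  move=> [L dL La]; pose scale (l : term) :=
    let: (x, s, j, t) := l in (k * x, s, j, t).
  exists [seq scale l | l <- L].
    by rewrite all_map; apply: sub_all dL => -[[[x s] j] t].
  move=> w wq; rewrite [RHS]wcoefZ -[in RHS]La // /combination big_map.
  rewrite [LHS]wcoef_sum [in RHS]wcoef_sum mulr_sumr.
  apply: eq_bigr => -[[[x s] j] t] _.
  by rewrite /= [LHS]wcoefZ [in RHS]wcoefZ mulrA.
move=> Ia hom_a; have : S (word [::] * a * word [::]).
  pose J := [set b | forall u v, range word u -> range word v -> S (u * b * v)].
  have J_ideal : two_sided_ideal J.
    apply: two_sided_ideal_conductor SZ => //; last first.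
    - by move=> _ _ [s _ <-] [t _ <-]; exists (s ++ t); rewrite ?wordM.
    - exact: free_alg_scaleAr.
    by move=> P P0 PD PZ; apply: free_alg_ind => // k s; apply: PZ; exists s.
  apply: (Ia J J_ideal) => [j||]; [|by exists [::]|by exists [::]].
  move=> _ _ [s _ <-] [t _ <-].
  have [stq|stq] := eqVneq (size s + size t).+2 q.
    exists [:: (1, s, j, t)]; first by rewrite /= stq eqxx.
    by move=> w _; rewrite /combination big_seq1 scale1r.
  exists [::] => // w wq; rewrite /combination big_nil wcoef0.
  rewrite wcoef_translate_relator big1 // => k _; rewrite big1 // => m _.
  case: eqVneq => [ew|_]; rewrite ?mulr0 //.
  by move: stq; rewrite -wq -ew size_cat /= !addnS eqxx.
rewrite word1 mul1r mulr1 => -[L dL La]; exists L => //.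
apply: free_algP => w; have [/eqP/La //|wq] := boolP (size w == q).
have /homogeneousP -> // := @combination_homogeneous q c _ dL.
by move/homogeneousP: hom_a => ->.
Qed.

Lemma polynomial_combination w L :
  polynomial_fun (fun c => wcoef w (combination c L)).
Proof.
have -> : (fun c => wcoef w (combination c L)) = (fun c => \sum_(l <- L)
    let: (x, s, j, t) := l in x * \sum_(k < n) \sum_(m < n)
      c (j, k, m) * (s ++ [:: k, m & t] == w)%:R).
  apply/funext => c; rewrite /combination wcoef_sum; apply: eq_bigr.
  by move=> [[[x s] j] t] _ /=; rewrite wcoefZ wcoef_translate_relator.
apply: polynomial_sum => -[[[x s] j] t].
apply: polynomialM; first exact: polynomial_cst.
apply: polynomial_sum => k; apply: polynomial_sum => m.
by apply: polynomialM; [apply: polynomial_coord | apply: polynomial_cst].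
Qed.

(** With combinations L w that express the words w of length q at c0, the
    coefficients of the L w evaluated at c form a square matrix A c with
    A c0 = 1.  Its inverse, where it exists, expresses the words through
    elements of the ideal at c. *)
Lemma generic_words_ideal q c0 : infinite_set [set: K] ->
  (forall w : q.-tuple 'I_n, ideal_generated (relator c0) (word w)) ->
  exists U : set (coefs K n d), [/\ open U, dense U & forall c, U c ->
    forall w : q.-tuple 'I_n, ideal_generated (relator c) (word w)].
Proof.
move=> Kinf word_ideal.
have /choice[L LP] : forall w : q.-tuple 'I_n,
    exists L, all (of_degree q) L /\ combination c0 L = word w.
  move=> w; have [||L] := @ideal_combination q c0 (word w).
  - exact: word_ideal.
  - by rewrite -[X in homogeneous X](size_tuple w); apply: word_homogeneous.
  by exists L.
pose A c : 'M[K]_#|{: q.-tuple 'I_n}| :=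
  \matrix_(i, j)
    wcoef (enum_val j : q.-tuple 'I_n) (combination c (L (enum_val i))).
have [||oU dU] := @open_dense_polynomial_neq0 _ _ (fun c => \det (A c)) c0 Kinf.
- apply: polynomial_det => i j.
  have -> : (fun c => A c i j) = (fun c =>
      wcoef (enum_val j : q.-tuple 'I_n) (combination c (L (enum_val i)))).
    by apply/funext => c; rewrite mxE.
  exact: polynomial_combination.
- suff -> : A c0 = 1%:M by rewrite det1 oner_neq0.
  apply/matrixP => i j; rewrite !mxE (LP _).2 wcoef_word val_eqE.
  by rewrite (inj_eq enum_val_inj).
exists [set c | \det (A c) != 0]; split; [exact: oU | exact: dU |].
move=> c /= detA w.
have uA : A c \in unitmx by rewrite unitmxE unitfE.
have -> : word w =
    \sum_i invmx (A c) (enum_rank w) i *: combination c (L (enum_val i)).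
  apply: free_algP => s; have [sq|sq] := eqVneq (size s) q; last first.
    rewrite wcoef_sum wcoef_word big1 => [|i _].
      by case: (tval w =P s) sq => [<-|//]; rewrite size_tuple eqxx.
    have /homogeneousP h := @combination_homogeneous q c _ (LP (enum_val i)).1.
    by rewrite wcoefZ h ?mulr0.
  have -> : s = enum_val (enum_rank (Tuple (introT eqP sq))).
    by rewrite enum_rankK.
  set j := enum_rank _.
  rewrite wcoef_sum; transitivity ((invmx (A c) *m A c) (enum_rank w) j).
    rewrite mulVmx // mxE wcoef_word val_eqE.
    by rewrite -[in LHS](enum_rankK w) (inj_eq enum_val_inj).
  by rewrite mxE; apply: eq_bigr => i _; rewrite wcoefZ mxE.
apply: (two_sided_ideal_lincomb _ _ (ideal_generatedP _)).
by move=> i; apply: combination_ideal.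
Qed.

(** The minor of the coefficient matrix at d distinct words e j of length 2 is
    the identity when the j-th relator is e j. *)
Lemma generic_lin_indep : infinite_set [set: K] -> (d <= n ^ 2)%N ->
  exists U : set (coefs K n d),
    [/\ open U, dense U & forall c, U c -> lin_indep (relator c)].
Proof.
move=> Kinf dn; have dcard : (d <= #|{: 'I_n * 'I_n}|)%N.
  by rewrite card_prod card_ord.
pose e (j : 'I_d) : 'I_n * 'I_n := enum_val (widen_ord dcard j).
have e_inj : injective e.
  by move=> i j /enum_val_inj/(congr1 val) /= ij; apply: val_inj.
pose A c : 'M[K]_d := \matrix_(i, j) c (i, (e j).1, (e j).2).
pose c0 : coefs K n d := fun i => (e i.1.1 == (i.1.2, i.2))%:R.
have [||oU dU] := @open_dense_polynomial_neq0 _ _ (fun c => \det (A c)) c0 Kinf.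
- apply: polynomial_det => i j.
  have -> : (fun c => A c i j) = (fun c => c (i, (e j).1, (e j).2)).
    by apply/funext => c; rewrite mxE.
  exact: polynomial_coord.
- suff -> : A c0 = 1%:M by rewrite det1 oner_neq0.
  apply/matrixP => i j.
  by rewrite !mxE /c0 /= -surjective_pairing (inj_eq e_inj).
exists [set c | \det (A c) != 0]; split; [exact: oU | exact: dU |].
move=> c /= detA a a0 i.
have uA : A c \in unitmx by rewrite unitmxE unitfE.
have : \row_j a j = 0.
  rewrite -[LHS](mulmxK uA); suff -> : \row_j a j *m A c = 0 by rewrite mul0mx.
  apply/rowP => j; rewrite !mxE -[RHS](wcoef0 [:: (e j).1; (e j).2]) -a0.
  rewrite wcoef_sum; apply: eq_bigr => k _.
  by rewrite !mxE wcoefZ wcoef_relator.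
by move=> /rowP/(_ i); rewrite !mxE.
Qed.
End Combinations.

(** * The blow-up of the three relations *)

Section BlowUp.
Context {Q : pzRingType} {I : Type} (X : option bool -> I -> Q).

(** A word in the operators [shift_mul p], applied to the constant 1, sends a
    sequence of indices to the product of the letters that carry these indices
    one after the other.  The relations, which hold for all indices, thus
    become relations between operators without indices. *)
Definition shift_mul p (phi : (nat -> I) -> Q) : (nat -> I) -> Q :=
  fun alpha => X p (alpha 0%N) * phi (fun i => alpha i.+1).

Lemma shift_mul_is_additive p : zmod_morphism (shift_mul p).
Proof. by move=> phi psi; apply/funext => alpha; rewrite /shift_mul mulrBr. Qed.

HB.instance Definition _ p := GRing.isZmodMorphism.Build
  ((nat -> I) -> Q) ((nat -> I) -> Q) (shift_mul p) (shift_mul_is_additive p).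

Lemma blow_up_word5_eq0 :
  (forall b i j, X (Some b) i * X None j = X (Some b) i * X (Some b) j) ->
  (forall i j, X None i * X None j =
    X (Some true) i * X (Some false) j + X (Some false) i * X (Some true) j) ->
  forall p1 p2 p3 p4 p5 i1 i2 i3 i4 i5,
    X p1 i1 * (X p2 i2 * (X p3 i3 * (X p4 i4 * X p5 i5))) = 0.
Proof.
move=> Xz zz p1 p2 p3 p4 p5 i1 i2 i3 i4 i5.
have nil_shift : nil_relations (shift_mul (Some true)) (shift_mul (Some false))
    (shift_mul None).
  split=> phi; apply/funext => alpha; rewrite /shift_mul /= ?mulrA ?Xz //.
  by rewrite zz mulrDl -!mulrA.
have := word5_eq0 nil_shift p1 p2 p3 p4 p5 (fun=> 1).
move=> /(congr1 (fun phi => phi (nth i1 [:: i1; i2; i3; i4; i5]))).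
by rewrite /= /shift_mul /= mulr1.
Qed.
End BlowUp.

Section QuadraticForms.
Context {K : fieldType} {A : lalgType K} {n : nat} (g : 'I_n -> A).
Hypothesis scaleAr : forall (k : K) (a b : A), a * (k *: b) = k *: (a * b).
Implicit Types u v w : 'I_n -> K.

Let lin u : A := \sum_k u k *: g k.

Let lin_mul u v : lin u * lin v = \sum_k \sum_m (u k * v m) *: (g k * g m).
Proof.
rewrite mulr_suml; apply: eq_bigr => k _; rewrite mulr_sumr.
by apply: eq_bigr => m _; rewrite scaleAr -scalerAl scalerA mulrC.
Qed.

Lemma lincomb_mulB u v w :
  \sum_k \sum_m (u k * (v m - w m)) *: (g k * g m) =
  lin u * lin v - lin u * lin w.
Proof.
rewrite !lin_mul -sumrB; apply: eq_bigr => k _; rewrite -sumrB.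
by apply: eq_bigr => m _; rewrite -scalerBl -mulrBr.
Qed.

Lemma lincomb_mulBB u v u1 v1 u2 v2 :
  \sum_k \sum_m (u k * v m - u1 k * v1 m - u2 k * v2 m) *: (g k * g m) =
  lin u * lin v - (lin u1 * lin v1 + lin u2 * lin v2).
Proof.
rewrite opprD addrA !lin_mul -!sumrB; apply: eq_bigr => k _; rewrite -!sumrB.
by apply: eq_bigr => m _; rewrite -!scalerBl.
Qed.
End QuadraticForms.

Section Witness.
Context (K : fieldType) (n d N : nat).
Hypotheses (n_le : (n <= 3 * N)%N) (d_ge : (3 * N ^ 2 <= d)%N).

Definition letter_index (p : option bool) (i : 'I_N) : nat :=
  (if p is Some b then if b then 0 else N else 2 * N)%N + i.

(** An index that is not below n belongs to no generator; the coefficients of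
    such a copy are all 0. *)
Definition letter_coef p i (k : 'I_n) : K := (k == letter_index p i :> nat)%:R.

Definition copy p i : @free_alg K n := \sum_k letter_coef p i k *: gen k.

(** The relators x_i (z_j - x_j), y_i (z_j - y_j) and
    z_i z_j - x_i y_j - y_i x_j. *)
Definition blow_up_coef (r : option bool * 'I_N * 'I_N) (k m : 'I_n) : K :=
  let: (p, i, j) := r in
  if p is Some b
  then letter_coef p i k * (letter_coef None j m - letter_coef p j m)
  else letter_coef None i k * letter_coef None j m
     - letter_coef (Some true) i k * letter_coef (Some false) j m
     - letter_coef (Some false) i k * letter_coef (Some true) j m.

(** The relators are numbered through the enumeration of the triples
    (letter, index, index); those beyond the enumeration are 0. *)
Definition blow_up_witness : coefs K n d := fun l =>
  if insub (val l.1.1) : option 'I_#|{: option bool * 'I_N * 'I_N}| is Some r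
  then blow_up_coef (enum_val r) l.1.2 l.2 else 0.

Lemma relator_witness r : exists l, relator blow_up_witness l =
  \sum_k \sum_m blow_up_coef r k m *: (gen k * gen m).
Proof.
have dcard : (#|{: option bool * 'I_N * 'I_N}| <= d)%N.
  by rewrite !card_prod card_option card_bool card_ord -mulnA mulnn.
exists (widen_ord dcard (enum_rank r)); apply: eq_bigr => k _.
by apply: eq_bigr => m _; rewrite /blow_up_witness /= valK enum_rankK.
Qed.

Local Notation cls := (class (relator blow_up_witness)).

Lemma class_copy_Some b i j :
  cls (copy (Some b) i) * cls (copy None j) =
  cls (copy (Some b) i) * cls (copy (Some b) j).
Proof.
have [l rl] := relator_witness (Some b, i, j).
have := rl; rewrite (lincomb_mulB gen (@free_alg_scaleAr K n)) => {}rl.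
have /class_congr : ideal_generated (relator blow_up_witness)
    (copy (Some b) i * copy None j - copy (Some b) i * copy (Some b) j).
  by move=> J _ /(_ l); rewrite rl.
move=> eq_class.
exact: etrans (esym (classM _ _ _)) (etrans eq_class (classM _ _ _)).
Qed.

Lemma class_copy_None i j : cls (copy None i) * cls (copy None j) =
  cls (copy (Some true) i) * cls (copy (Some false) j)
  + cls (copy (Some false) i) * cls (copy (Some true) j).
Proof.
have [l rl] := relator_witness (None, i, j).
have := rl; rewrite (lincomb_mulBB gen (@free_alg_scaleAr K n)) => {}rl.
have /class_congr : ideal_generated (relator blow_up_witness)
    (copy None i * copy None j - (copy (Some true) i * copy (Some false) j
       + copy (Some false) i * copy (Some true) j)).
  by move=> J _ /(_ l); rewrite rl.
move=> eq_class; apply: etrans (esym (classM _ _ _)) (etrans eq_class _).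
exact: etrans (classD _ _ _) (congr2 +%R (classM _ _ _) (classM _ _ _)).
Qed.

Lemma gen_copy (k : 'I_n) : exists p i, gen k = copy p i.
Proof.
have [p [i ki]] : exists p i, k = letter_index p i :> nat.
  have k3N := leq_trans (ltn_ord k) n_le.
  have [kN|Nk] := ltnP k N; first by exists (Some true), (Ordinal kN).
  have [k2N|N2k] := ltnP k (2 * N).
    have lt : (k - N < N)%N by lia.
    by exists (Some false), (Ordinal lt); rewrite /letter_index /=; lia.
  have lt : (k - 2 * N < N)%N by lia.
  by exists None, (Ordinal lt); rewrite /letter_index /=; lia.
exists p, i; rewrite /copy (bigD1 k) //= /letter_coef ki eqxx scale1r.
rewrite big1 ?addr0 // => m /negPf mk.
by rewrite -ki val_eqE mk scale0r.
Qed.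

Lemma witness_words_ideal (w : 5.-tuple 'I_n) :
  ideal_generated (relator blow_up_witness) (word w).
Proof.
apply/class_eq0; case: w => -[|k1 [|k2 [|k3 [|k4 [|k5 [|//]]]]]] //= _.
rewrite -[[:: k1, k2 & _]]cat1s -[[:: k2, k3 & _]]cat1s -[[:: k3, k4 & _]]cat1s.
rewrite -[[:: k4; k5]]cat1s -!wordM -!genE !classM.
have [p1 [i1 ->]] := gen_copy k1; have [p2 [i2 ->]] := gen_copy k2.
have [p3 [i3 ->]] := gen_copy k3; have [p4 [i4 ->]] := gen_copy k4.
have [p5 [i5 ->]] := gen_copy k5.
apply: (blow_up_word5_eq0 (X := fun p i => cls (copy p i))).
  exact: class_copy_Some.
exact: class_copy_None.
Qed.
End Witness.

(** * The theorem *)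

Theorem corollary1p7 (K : fieldType) (R : realType) (d : nat -> nat) :
  infinite_set [set: K] ->
  (forall n : nat, (0 < n)%N -> (0 < d n <= n ^ 2)%N) ->
  ((3%:R^-1 : R)%:E < limn_einf (fun n => ((d n)%:R / n%:R ^+ 2 : R)%:E))%E ->
  exists n0 : nat, forall n : nat, (n0 <= n)%N ->
    generic_quadratic
      (fun c : coefs K n (d n) => hilbert_series_poly_deg_le 4 c).
Proof.
move=> Kinf d_le /eventually_three_blocks[n0 blocks].
exists n0 => n /blocks[n_gt0 d_ge].
have n_le : (n <= 3 * (n %/ 3).+1)%N by lia.
have [U [oU dU ideal5]] :=
  generic_words_ideal Kinf (witness_words_ideal n_le d_ge).
have /andP[_ dn] := d_le n n_gt0.
have [V [oV dV indepV]] := generic_lin_indep Kinf dn.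
exists (U `&` V); split; [exact: openI|exact: denseI|move=> c [Uc Vc]].
split; first exact: indepV.
by apply: hilbert_series_of_words; apply: ideal5.
Qed.
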